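(* Let $G$ be a group, $X$ a non-empty set and $\sigma:G\to\mathrm{Sym}(X)$, $\sigma(a)=:\sigma_a$, a map (not necessarily a homomorphism). Then the pair $(X\times G,s)$ given by $$s((x,a),(y,b)):=((x,a),(\sigma_{a^{-1}b}\,\sigma_b^{-1}(y),\,a^{-1}b))$$ is a commutative non-degenerate solution on the left-zero semigroup having $X\times G$ as underlying set. This solution is involutive if and only if $G$ is an elementary abelian $2$-group. Moreover, $\mathrm{Ret}(X\times G,s)\cong(G,s_G)$, where $s_G(g,h)=(g,g^{-1}h)$.
   Context: A solution (set-theoretic solution of the Pentagon Equation) is a pair $(S,s)$ with $S$ a non-empty set and $s:S\times S\to S\times S$ a map such that $s_{23}s_{13}s_{12}=s_{12}s_{23}$ as maps $S^3\to S^3$, where $s_{12}=s\times \mathrm{id}$, $s_{23}=\mathrm{id}\times s$, $s_{13}=(\tau\times \mathrm{id})(\mathrm{id}\times s)(\tau\times \mathrm{id})$ and $\tau(x,y)=(y,x)$. Writing $s(x,y)=(x\cdot y,\theta_x(y))$, the pair $(S,s)$ is a solution if and only if for all $x,y,z\in S$: $(x\cdot y)\cdot z=x\cdot(y\cdot z)$, $\theta_x(y)\cdot\theta_{x\cdot y}(z)=\theta_x(y\cdot z)$, and $\theta_{\theta_x(y)}\theta_{x\cdot y}=\theta_y$; one says $(S,s)$ is a solution on the semigroup $(S,\cdot)$. It is involutive if $s^2=\mathrm{id}_{S\times S}$. It is commutative if $s_{12}s_{13}=s_{13}s_{12}$, equivalently $x\cdot y\cdot z=x\cdot z\cdot y$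 and $\theta_{x\cdot y}=\theta_x$ for all $x,y,z\in S$. It is non-degenerate if every $\theta_x:S\to S$ is bijective. A semigroup is left-zero if $x\cdot y=x$ for all $x,y$. For a commutative non-degenerate solution, the retract relation is $x\sim y\iff\theta_x=\theta_y$; the retraction $\mathrm{Ret}(S,s)$ is the induced solution on $S/\!\sim$ given by $\bar s(\bar x,\bar y)=(\overline{x\cdot y},\overline{\theta_x(y)})$. Two solutions $(S,s)$, $(T,t)$ are isomorphic ($\cong$) if there is a bijection $\phi:S\to T$ with $(\phi\times\phi)s=t(\phi\times\phi)$. An elementary abelian $2$-group is a group (possibly trivial) in which $g^2=1$ for every $g$. *)

(* Defs.v *)
(* The quotient construction below needs a choiceType; by boolp.gen_choiceMixin
   every type carries such a structure, so this is no restriction on sets. *)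
From HB Require Import structures.
From mathcomp Require Import all_boot boolp.

Set Implicit Arguments.
Unset Strict Implicit.
Unset Printing Implicit Defensive.

Local Open Scope group_scope.
Local Open Scope quotient_scope.

Section Solutions.
Variable S : Type.
Implicit Types (s : S * S -> S * S) (p : S * S * S).

(* S^3 is encoded as (S * S) * S, and composition is right to left. *)
Definition s12 s p : S * S * S := (s p.1, p.2).
Definition s23 s p : S * S * S :=
  let: (x, y, z) := p in let: (y', z') := s (y, z) in (x, y', z').
Definition tau12 p : S * S * S := let: (x, y, z) := p in (y, x, z).
Definition s13 s : S * S * S -> S * S * S := tau12 \o s23 s \o tau12.

Definition pentagon s := s23 s \o s13 s \o s12 s =1 s12 s \o s23 s.
Definition is_solution s := inhabited S /\ pentagon s.

(* s (x, y) = (op s x y, theta s x y) *)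
Definition op s (x y : S) : S := (s (x, y)).1.
Definition theta s (x y : S) : S := (s (x, y)).2.

Definition commutative_sol s := s12 s \o s13 s =1 s13 s \o s12 s.
Definition nondegenerate s := forall x, bijective (theta s x).
Definition involutive_sol s := s \o s =1 id.

Definition left_zero_semigroup (m : S -> S -> S) :=
  associative m /\ forall x y, m x y = x.

Local Arguments s12 : simpl never.
Local Arguments s23 : simpl never.
Local Arguments s13 : simpl never.

Lemma s12E s x y z : s12 s (x, y, z) = (op s x y, theta s x y, z).
Proof. by rewrite /s12 /op /theta -surjective_pairing. Qed.

Lemma s23E s x y z : s23 s (x, y, z) = (x, op s y z, theta s y z).
Proof. by rewrite /s23 /op /theta; case: (s (y, z)). Qed.

Lemma s13E s x y z : s13 s (x, y, z) = (op s x z, y, theta s x z).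
Proof. by rewrite /s13 /= s23E. Qed.

Lemma pentagonP s : pentagon s <->
  [/\ associative (op s),
      forall x y z, op s (theta s x y) (theta s (op s x y) z)
                    = theta s x (op s y z)
    & forall x y, theta s (theta s x y) \o theta s (op s x y) =1 theta s y].
Proof.
split=> [H|[H1 H2 H3] [[x y] z]]; last first.
  by rewrite /= !(s12E, s23E, s13E) H1 H2 -(H3 x y z).
have E x y z := H (x, y, z).
by split=> [x y z|x y z|x y z]; have := E x y z;
  rewrite /= !(s12E, s23E, s13E) => -[].
Qed.

Lemma commutative_solP s : commutative_sol s <->
  (forall x y z, op s (op s x y) z = op s (op s x z) y) /\
  (forall x y, theta s (op s x y) =1 theta s x).
Proof.
split=> [H|[H1 H2] [[x y] z]]; last first.
  by rewrite /= !(s12E, s13E) H1 !H2.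
have E x y z := H (x, y, z).
by split=> [x y z|x y z]; have := E x y z; rewrite /= !(s12E, s13E) => -[].
Qed.

End Solutions.

Definition sol_isomorphic (S T : Type)
    (s : S * S -> S * S) (t : T * T -> T * T) :=
  exists2 phi : S -> T, bijective phi &
    forall x y, (phi (s (x, y)).1, phi (s (x, y)).2) = t (phi x, phi y).

Section Retraction.
Variable S : choiceType.
Implicit Types s : S * S -> S * S.

Definition retract_rel s : rel S := fun x y => `[< theta s x =1 theta s y >].

Lemma retract_refl s : reflexive (retract_rel s).
Proof. by move=> x; apply/asboolP. Qed.

Lemma retract_sym s : symmetric (retract_rel s).
Proof. by move=> x y; apply/asboolP/asboolP => h z; rewrite h. Qed.

Lemma retract_trans s : transitive (retract_rel s).
Proof.
by move=> y x z /asboolP h1 /asboolP h2; apply/asboolP => t; rewrite h1.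
Qed.

Canonical retract_equiv s :=
  EquivRel (retract_rel s) (@retract_refl s) (@retract_sym s)
    (@retract_trans s).

Definition Ret s : Type := {eq_quot retract_equiv s}.

Definition Ret_class s (x : S) : Ret s := \pi_{eq_quot retract_equiv s} x.

(* The induced map, computed on representatives; by [Ret_mapE] it does not
   depend on them when s is a commutative non-degenerate solution. *)
Definition Ret_map s (p : Ret s * Ret s) : Ret s * Ret s :=
  let q := s (repr (p.1 : {eq_quot retract_equiv s}),
              repr (p.2 : {eq_quot retract_equiv s})) in
  (Ret_class s q.1, Ret_class s q.2).

Lemma Ret_classP s x y :
  Ret_class s x = Ret_class s y <-> theta s x =1 theta s y.
Proof.
by split=> [/eqmodP/asboolP|h] //; apply/eqmodP/asboolP.
Qed.

Lemma Ret_classK s (u : Ret s) :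
  Ret_class s (repr (u : {eq_quot retract_equiv s})) = u.
Proof. exact: reprK. Qed.

Lemma Ret_mapE s : is_solution s -> commutative_sol s -> nondegenerate s ->
  forall x y, Ret_map (Ret_class s x, Ret_class s y)
              = (Ret_class s (op s x y), Ret_class s (theta s x y)).
Proof.
move=> [_ /pentagonP[_ _ s3]] /commutative_solP[_ c2] nd x y.
rewrite /Ret_map /=.
set x' := repr _; set y' := repr _.
have /Ret_classP hx : Ret_class s x' = Ret_class s x by exact: Ret_classK.
have /Ret_classP hy : Ret_class s y' = Ret_class s y by exact: Ret_classK.
congr pair; apply/Ret_classP => z; first by rewrite !c2 hx.
have [g _ gK] := nd x.
have E := s3 x y (g z); have E' := s3 x' y' (g z).
move: E E'; rewrite /= !c2 !(hx (g z)) gK hy => E E'.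
by rewrite E -E'.
Qed.

Lemma Ret_solution s : is_solution s -> commutative_sol s ->
  nondegenerate s -> is_solution (@Ret_map s).
Proof.
move=> sol com nd; have E := Ret_mapE sol com nd.
have [[x0] /pentagonP[s1 s2 s3]] := sol.
split; first by exists; exact: (Ret_class s x0).
have opE x y : op (@Ret_map s) (Ret_class s x) (Ret_class s y)
  = Ret_class s (op s x y) by rewrite {1}/op E.
have thE x y : theta (@Ret_map s) (Ret_class s x) (Ret_class s y)
  = Ret_class s (theta s x y) by rewrite {1}/theta E.
apply/pentagonP; split=> [u v w|u v w|u v w];
  rewrite -(Ret_classK u) -(Ret_classK v) -(Ret_classK w) /= !(opE, thE).
- by rewrite s1.
- by rewrite s2.
- by congr Ret_class; exact: s3.
Qed.

End Retraction.

(* Permutations of an arbitrary, possibly infinite set; MathComp's {perm X}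
   is restricted to finite types. *)
Record Sym (X : Type) := MkSym {
  sym_fun :> X -> X;
  sym_inv : X -> X;
  sym_funK : cancel sym_fun sym_inv;
  sym_invK : cancel sym_inv sym_fun
}.

Definition elementary_abelian_2group (G : groupType) :=
  forall g : G, g ^+ 2 = 1.

Definition sigma_map (G : groupType) (X : Type) (sigma : G -> Sym X)
    (p : (X * G) * (X * G)) : (X * G) * (X * G) :=
  let: ((x, a), (y, b)) := p in
  ((x, a), (sigma (a^-1 * b) (sym_inv (sigma b) y), a^-1 * b)).

Definition group_sol (G : groupType) (p : G * G) : G * G :=
  (p.1, p.1^-1 * p.2).

(* Main.v *)
Require Import Defs.
From mathcomp Require Import all_boot.

(** In the coordinates [(sigma_b^{-1} y, b)] on [X * G] the permutation
    [sigma_{a^{-1} b} sigma_b^{-1}] of the first component disappears, so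
    [theta_{(x, a)}] is conjugate to the identity of [X] times the left
    translation by [a^{-1}].  It therefore depends on [a] only, and
    [a |-> theta_{(x, a)}] turns products of [G] into reversed composites
    ([theta_sigma_comp], [theta_sigma_1]).

    Since the semigroup is left-zero, the solution axioms reduce to
    [theta_{theta_p q} theta_p = theta_q]: the second components of
    [theta_p q], [p] and [q] are [a^{-1} b], [a] and [b], so this is
    [a (a^{-1} b) = b].  Likewise [theta_{(x, a)}] is inverted by
    [theta_{(x, a^{-1})}], and [s] squares to the identity exactly when every
    [theta_{(x, a^2)}] is the identity.  As [X] is non-empty, the map
    [theta_{(x, a)}] determines [a] ([theta_sigma_eqP]); the retraction thus
    forgets precisely the [X] component, which leaves [(g, h) |-> (g, g^{-1} h)]
    on [G]. *)

Set Implicit Arguments.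
Unset Strict Implicit.
Unset Printing Implicit Defensive.

Local Open Scope group_scope.
Local Open Scope quotient_scope.

Section SigmaMap.
Variables (G : groupType) (X : choiceType) (sigma : G -> Sym X).
Implicit Types p q r : X * G.

Let s := sigma_map sigma.

Lemma sigma_mapE p q : s (p, q) = (p, theta s p q).
Proof. by case: p q => [x a] [y b]. Qed.

Lemma op_sigma p q : op s p q = p.
Proof. by rewrite /op sigma_mapE. Qed.

Lemma theta_sigma_snd p q : (theta s p q).2 = p.2^-1 * q.2.
Proof. by case: p q => [x a] [y b]. Qed.

(** The factor [sigma_c^{-1}] of the outer map cancels the factor [sigma_c] of
    the inner one, as [c] is the second component of the inner value. *)
Lemma theta_sigma_comp p q r x :
  theta s p (theta s q r) = theta s (x, q.2 * p.2) r.
Proof.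
by case: p q r => [y a] [z b] [t c]; rewrite /theta /= sym_funK invgM mulgA.
Qed.

Lemma theta_sigma_1 x q : theta s (x, 1) q = q.
Proof. by case: q => y b; rewrite /theta /= invg1 mul1g sym_invK. Qed.

Lemma theta_sigma_eqP p q : inhabited X ->
  theta s p =1 theta s q <-> p.2 = q.2.
Proof.
case=> x0; split=> [E|]; last by case: p q => [x a] [y b] /= -> [].
have /(congr1 snd) := E (x0, 1).
by rewrite !theta_sigma_snd !mulg1 => /invg_inj.
Qed.

Lemma sigma_left_zero : left_zero_semigroup (op s).
Proof. by split=> [p q r|p q]; rewrite !op_sigma. Qed.

Lemma sigma_solution : inhabited X -> is_solution s.
Proof.
case=> x0; split; first exact: (inhabits (x0, 1)).
apply/pentagonP; split=> [p q r|p q r|p q r]; rewrite ?op_sigma //=.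
rewrite (theta_sigma_comp _ _ _ q.1) theta_sigma_snd mulVKg.
by rewrite -surjective_pairing.
Qed.

Lemma sigma_commutative : commutative_sol s.
Proof.
by apply/commutative_solP; split=> [p q r|p q r]; rewrite !op_sigma.
Qed.

Lemma sigma_nondegenerate : nondegenerate s.
Proof.
move=> p; exists (theta s (p.1, p.2^-1)) => q;
  by rewrite (theta_sigma_comp _ _ _ p.1) /= ?mulgV ?mulVg theta_sigma_1.
Qed.

Lemma sigma_involutiveP : inhabited X ->
  involutive_sol s <-> elementary_abelian_2group G.
Proof.
case=> x0.
have sqE p q : s (s (p, q)) = (p, theta s (p.1, p.2 ^+ 2) q).
  by rewrite !sigma_mapE (theta_sigma_comp _ _ _ p.1) expg2.
split=> [inv g|exp2 [p q]]; last by rewrite [LHS]sqE exp2 theta_sigma_1.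
have := inv ((x0, g), (x0, 1)); rewrite [LHS]sqE => /(congr1 (snd \o snd)).
by rewrite [LHS]theta_sigma_snd /= mulg1 => /eqP; rewrite invg_eq1 => /eqP.
Qed.

Lemma sigma_retraction : inhabited X ->
  sol_isomorphic (@Ret_map _ s) (@group_sol G).
Proof.
move=> hX; have [x0] := hX.
pose phi (u : Ret s) : G := (repr (u : {eq_quot retract_equiv s})).2.
have phiE p : phi (Ret_class s p) = p.2.
  by apply/(theta_sigma_eqP _ _ hX)/Ret_classP; rewrite Ret_classK.
exists phi => [|u v]; last first.
  by rewrite /Ret_map !phiE sigma_mapE /= theta_sigma_snd.
exists (fun g => Ret_class s (x0, g)) => [u|g]; last by rewrite phiE.
by rewrite -[RHS]Ret_classK; apply/Ret_classP/(theta_sigma_eqP _ _ hX).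
Qed.

End SigmaMap.

Theorem proposition25 (G : groupType) (X : choiceType) (hX : inhabited X)
    (sigma : G -> Sym X) :
  [/\ [/\ is_solution (sigma_map sigma),
          commutative_sol (sigma_map sigma),
          nondegenerate (sigma_map sigma)
        & left_zero_semigroup (op (sigma_map sigma))],
      involutive_sol (sigma_map sigma) <-> elementary_abelian_2group G
    & sol_isomorphic (@Ret_map _ (sigma_map sigma)) (@group_sol G)].
Proof.
split; last exact: sigma_retraction.
  split; [exact: sigma_solution | exact: sigma_commutative
         | exact: sigma_nondegenerate | exact: sigma_left_zero].
exact: sigma_involutiveP.
Qed.
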